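(* For states $u_\pm=(\rho_\pm,v_\pm,p_\pm)$, consider the numerical flux $f^{\mathrm{num}}=(f^{\mathrm{num}}_{\rho},f^{\mathrm{num}}_{\rho v},f^{\mathrm{num}}_{\rho e})$ for the one-dimensional compressible Euler equations given by $$f^{\mathrm{num}}_{\rho}=\{\{\rho\}\}_{\log}\{\{v\}\},$$ $$f^{\mathrm{num}}_{\rho v}=\{\{\rho\}\}_{\log}\{\{v\}\}^2+\{\{p\}\},$$ $$f^{\mathrm{num}}_{\rho e}=\tfrac12\{\{\rho\}\}_{\log}\{\{v\}\}((v\cdot v))+\tfrac{1}{\gamma-1}\{\{\rho\}\}_{\log}\{\{\rho/p\}\}_{\log}^{-1}\{\{v\}\}+((p\cdot v)).$$ This numerical flux is EC, KEP and PEP, and its density flux $f^{\mathrm{num}}_\rho$ does not depend on the pressures $p_\pm$. Moreover, it is the only numerical flux with these properties for $v\equiv\mathrm{const}$; that is, any numerical flux that is EC, KEP, PEP and has a density flux that does not depend on $p_\pm$ coincides with the flux above at all pairs of states with $v_+=v_-$.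
   Context: The 1D compressible Euler equations are $\partial_t u+\partial_x f(u)=0$, $u=(\rho,\rho v,\rho e)$, $f(u)=(\rho v,\rho v^2+p,(\rho e+p)v)$, $p=(\gamma-1)(\rho e-\frac12\rho v^2)$, with $\gamma>1$. States are those with $\rho>0$, $p>0$, $v\in\mathbb{R}$, described by $(\rho,v,p)$. A numerical flux $f^{\mathrm{num}}(u_+,u_-)$ is a continuous function of two states that is consistent: $f^{\mathrm{num}}(u,u)=f(u)$. Notation: $[[a]]=a_+-a_-$, $\{\{a\}\}=(a_++a_-)/2$, $\{\{a\}\}_{\log}=[[a]]/[[\log a]]$ for positive $a_\pm$ (extended continuously by $\{\{a\}\}_{\log}=a$ if $a_+=a_-=a$), $((a\cdot b))=(a_+b_-+a_-b_+)/2$. The entropy is $U=-\rho s/(\gamma-1)$, $s=\log(p/\rho^\gamma)$, with entropy variables $w=\left(\frac{\gamma}{\gamma-1}-\frac{\log(p/\rho^\gamma)}{\gamma-1}-\frac{\rho v^2}{2p},\frac{\rho v}{p},-\frac{\rho}{p}\right)$ and flux potential $\psi=\rho v$. EC (entropy-conservative): $[[w]]\cdot f^{\mathrm{num}}-[[\psi]]=0$ for all pairs of states. KEP (kinetic-energy-preserving): $f^{\mathrm{num}}_{\rho v}=\{\{v\}\}f^{\mathrm{num}}_\rho+\{\{p\}\}$ for all pairs of states. PEP (pressure-equilibrium-preserving): whenever $v_+=v_-=v$ and $p_+=p_-=p$, one has $f^{\mathrm{num}}_{\rho v}=v f^{\mathrm{num}}_\rho+\mathrm{const}(p,v)$ and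 $f^{\mathrm{num}}_{\rho e}=\frac12v^2f^{\mathrm{num}}_\rho+\mathrm{const}(p,v)$, where each $\mathrm{const}(p,v)$ denotes a (possibly different) quantity depending only on $p$ and $v$, not on $\rho_\pm$. *)

(* Defs.v *)
From Stdlib Require Import Reals.
From Coquelicot Require Import Coquelicot.
Open Scope R_scope.

(** Vectors of R^3, used both for primitive states (rho, v, p) and for flux
    values (density, momentum, energy components). *)
Definition vec3 : Type := (R * R * R)%type.

Definition rho (a : vec3) : R := fst (fst a).
Definition vel (a : vec3) : R := snd (fst a).
Definition prs (a : vec3) : R := snd a.

Definition f_rho (F : vec3) : R := fst (fst F).
Definition f_mom (F : vec3) : R := snd (fst F).
Definition f_ene (F : vec3) : R := snd F.

Definition dot (x y : vec3) : R :=
  fst (fst x) * fst (fst y) + snd (fst x) * snd (fst y) + snd x * snd y.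

Definition vsub (x y : vec3) : vec3 :=
  (fst (fst x) - fst (fst y), snd (fst x) - snd (fst y), snd x - snd y).

(** In every two-point operator the "plus" value is the first argument. *)
Definition jump (ap am : R) : R := ap - am.
Definition avg (ap am : R) : R := (ap + am) / 2.
Definition logmean (ap am : R) : R :=
  if Req_dec_T ap am then ap else jump ap am / jump (ln ap) (ln am).
Definition prodmean (ap am bp bm : R) : R := (ap * bm + am * bp) / 2.

Definition is_state (a : vec3) : Prop := 0 < rho a /\ 0 < prs a.

(** Total energy rho e, from p = (gamma - 1) (rho e - rho v^2 / 2). *)
Definition energy (gamma : R) (a : vec3) : R :=
  prs a / (gamma - 1) + / 2 * rho a * vel a ^ 2.

Definition euler_flux (gamma : R) (a : vec3) : vec3 :=
  (rho a * vel a,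
   rho a * vel a ^ 2 + prs a,
   (energy gamma a + prs a) * vel a).

Definition entropy_s (gamma : R) (a : vec3) : R :=
  ln (prs a / Rpower (rho a) gamma).

Definition entropy_var (gamma : R) (a : vec3) : vec3 :=
  (gamma / (gamma - 1) - entropy_s gamma a / (gamma - 1)
     - rho a * vel a ^ 2 / (2 * prs a),
   rho a * vel a / prs a,
   - (rho a / prs a)).

Definition flux_potential (a : vec3) : R := rho a * vel a.

(** A two-point flux is a total function of (u_+, u_-), of which only the
    values at pairs of states are meaningful.  The states form an open set, so
    continuity at each pair of states is continuity on the set of such pairs;
    since (rho, v, p) |-> (rho, rho v, rho e) is a homeomorphism, primitive and
    conserved variables give the same notion. *)
Definition numerical_flux (gamma : R) (fnum : vec3 -> vec3 -> vec3) : Prop :=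
  (forall up um : vec3, is_state up -> is_state um ->
     continuous (fun u : vec3 * vec3 => fnum (fst u) (snd u)) (up, um)) /\
  (forall u : vec3, is_state u -> fnum u u = euler_flux gamma u).

Definition EC (gamma : R) (fnum : vec3 -> vec3 -> vec3) : Prop :=
  forall up um : vec3, is_state up -> is_state um ->
    dot (vsub (entropy_var gamma up) (entropy_var gamma um)) (fnum up um)
      - jump (flux_potential up) (flux_potential um) = 0.

Definition KEP (fnum : vec3 -> vec3 -> vec3) : Prop :=
  forall up um : vec3, is_state up -> is_state um ->
    f_mom (fnum up um) =
      avg (vel up) (vel um) * f_rho (fnum up um) + avg (prs up) (prs um).

Definition PEP (fnum : vec3 -> vec3 -> vec3) : Prop :=
  exists c_mom c_ene : R -> R -> R,
  forall up um : vec3, is_state up -> is_state um ->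
  forall v p : R, vel up = v -> vel um = v -> prs up = p -> prs um = p ->
    f_mom (fnum up um) = v * f_rho (fnum up um) + c_mom p v /\
    f_ene (fnum up um) = / 2 * v ^ 2 * f_rho (fnum up um) + c_ene p v.

Definition density_flux_indep_pressure (fnum : vec3 -> vec3 -> vec3) : Prop :=
  forall rhop rhom vp vm pp pm pp' pm' : R,
    0 < rhop -> 0 < rhom -> 0 < pp -> 0 < pm -> 0 < pp' -> 0 < pm' ->
    f_rho (fnum (rhop, vp, pp) (rhom, vm, pm)) =
    f_rho (fnum (rhop, vp, pp') (rhom, vm, pm')).

Definition fnum_star (gamma : R) (up um : vec3) : vec3 :=
  let rholog := logmean (rho up) (rho um) in
  let betalog := logmean (rho up / prs up) (rho um / prs um) in
  let vavg := avg (vel up) (vel um) in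
  (rholog * vavg,
   rholog * vavg ^ 2 + avg (prs up) (prs um),
   / 2 * rholog * vavg * prodmean (vel up) (vel um) (vel up) (vel um)
     + / (gamma - 1) * rholog * / betalog * vavg
     + prodmean (prs up) (prs um) (vel up) (vel um)).

(* Main.v *)
Require Import Defs.
From Stdlib Require Import Reals.
From Coquelicot Require Import Coquelicot.
From Stdlib Require Import Lra.
Open Scope R_scope.

(** With [beta = rho / p], the first entropy variable is, up to a constant,
    [ln rho + ln beta / (gamma - 1) - beta v^2 / 2], while the other two are
    [beta v] and [- beta].  The entropy balance of a two-point flux therefore
    involves the logarithms only through the jumps of [ln rho] and [ln beta].

    Existence.  The two logarithmic means in [fnum_star] are what turns these
    jumps into jumps of [rho] and [beta] ([logmean_mul_ln_jump]); after that
    substitution entropy conservation is an identity of rational functions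
    ([EC_fnum_star]).  Pressure equilibrium holds because the logarithmic mean
    is homogeneous ([logmean_div]): at constant pressure the mean of [beta] is
    the mean of [rho] divided by [p].  Continuity is immediate except where the
    logarithmic mean changes its defining formula, on the diagonal; there it is
    squeezed between its arguments ([logmean_between]).

    Uniqueness at equal velocities.  The KEP property eliminates the momentum
    flux, so the entropy balance becomes one linear relation between the density
    and the energy flux ([EC_balance_equal_velocity]).  At equal pressures the
    PEP property, with its constant identified by consistency, expresses the
    energy flux by the density flux; the relation then determines the density
    flux, and it determines it for all pressures because the density flux does
    not see them ([density_flux_unique]).  Back at arbitrary pressures, the
    relation determines the energy flux wherever [beta] jumps.  Where [beta]
    does not jump, moving [p_+] slightly makes it jump, and continuity of both
    fluxes concludes ([energy_flux_unique]). *)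

(** * The logarithmic mean *)

Lemma logmean_diag (a : R) : logmean a a = a.
Proof. unfold logmean; destruct (Req_dec_T a a); congruence. Qed.

Lemma ln_jump_neq_0 (a b : R) : 0 < a -> 0 < b -> a <> b -> ln a - ln b <> 0.
Proof. intros ha hb hab h; apply hab, ln_inv; lra. Qed.

Lemma logmean_mul_ln_jump (a b : R) :
  0 < a -> 0 < b -> logmean a b * (ln a - ln b) = a - b.
Proof.
  intros ha hb; unfold logmean, jump.
  destruct (Req_dec_T a b) as [<- | hab]; [ring | field].
  now apply ln_jump_neq_0.
Qed.

(** The tangent-line bound [ln x <= x - 1] at [x = a / b]; used in both orders
    of [a] and [b], it squeezes the logarithmic mean between [a] and [b]. *)
Lemma mul_ln_jump_le (a b : R) : 0 < a -> 0 < b -> b * (ln a - ln b) <= a - b.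
Proof.
  intros ha hb.
  assert (hx : 0 < a / b) by now apply Rdiv_lt_0_compat.
  pose proof (exp_ineq1_le (ln (a / b))) as h.
  rewrite exp_ln, ln_div in h by assumption.
  replace (a - b) with (b * (a / b - 1)) by (field; lra).
  apply Rmult_le_compat_l; lra.
Qed.

Lemma logmean_between (a b : R) :
  0 < a -> 0 < b -> Rmin a b <= logmean a b <= Rmax a b.
Proof.
  intros ha hb.
  destruct (Rtotal_order a b) as [hab | [<- | hab]].
  - pose proof (ln_increasing a b ha hab).
    pose proof (logmean_mul_ln_jump a b ha hb).
    pose proof (mul_ln_jump_le a b ha hb).
    pose proof (mul_ln_jump_le b a hb ha).
    rewrite Rmin_left, Rmax_right by lra.
    split; apply (Rmult_le_reg_r (ln b - ln a)); lra.
  - rewrite logmean_diag, Rmin_left, Rmax_left; lra.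
  - pose proof (ln_increasing b a hb hab).
    pose proof (logmean_mul_ln_jump a b ha hb).
    pose proof (mul_ln_jump_le a b ha hb).
    pose proof (mul_ln_jump_le b a hb ha).
    rewrite Rmin_right, Rmax_left by lra.
    split; apply (Rmult_le_reg_r (ln a - ln b)); lra.
Qed.

Lemma logmean_pos (a b : R) : 0 < a -> 0 < b -> 0 < logmean a b.
Proof.
  intros ha hb; apply Rlt_le_trans with (Rmin a b).
  - now apply Rmin_glb_lt.
  - now apply logmean_between.
Qed.

Lemma logmean_div (a b p : R) :
  0 < a -> 0 < b -> 0 < p -> logmean (a / p) (b / p) = logmean a b / p.
Proof.
  intros ha hb hp.
  destruct (Req_dec_T a b) as [<- | hab]; [now rewrite !logmean_diag |].
  assert (ha' : 0 < a / p) by now apply Rdiv_lt_0_compat.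
  assert (hb' : 0 < b / p) by now apply Rdiv_lt_0_compat.
  apply (Rmult_eq_reg_r (ln a - ln b)); [| now apply ln_jump_neq_0].
  transitivity ((a - b) / p).
  - replace (ln a - ln b) with (ln (a / p) - ln (b / p))
      by (rewrite !ln_div by assumption; ring).
    rewrite logmean_mul_ln_jump by assumption; field; lra.
  - rewrite <- (logmean_mul_ln_jump a b) by assumption; field; lra.
Qed.

(** * Continuity *)

(** The operations of [R], in place of those of an abstract normed module, make
    these rules apply to real expressions as they are written. *)
Section RealValuedContinuity.
Context {U : UniformSpace}.
Implicit Types (f g : U -> R) (x : U).

Lemma continuous_Rplus f g x :
  continuous f x -> continuous g x -> continuous (fun y => f y + g y) x.
Proof. exact (continuous_plus (V := R_NormedModule) f g x). Qed.

Lemma continuous_Rminus f g x :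
  continuous f x -> continuous g x -> continuous (fun y => f y - g y) x.
Proof. exact (continuous_minus (V := R_NormedModule) f g x). Qed.

Lemma continuous_Rmult f g x :
  continuous f x -> continuous g x -> continuous (fun y => f y * g y) x.
Proof. exact (continuous_mult (K := R_AbsRing) f g x). Qed.

Lemma continuous_Rdiv f g x :
  continuous f x -> continuous g x -> g x <> 0 ->
  continuous (fun y => f y / g y) x.
Proof.
  intros hf hg h0; apply continuous_Rmult; [assumption |].
  apply (continuous_comp g Rinv); [assumption | now apply continuous_Rinv].
Qed.

Lemma continuous_pair {V W : UniformSpace} (f : U -> V) (g : U -> W) x :
  continuous f x -> continuous g x ->
  continuous (U := prod_UniformSpace V W) (fun y => (f y, g y)) x.
Proof.
  intros hf hg; apply filterlim_locally; intros eps.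
  apply filter_and.
  - exact (proj1 (filterlim_locally f (f x)) hf eps).
  - exact (proj1 (filterlim_locally g (g x)) hg eps).
Qed.

End RealValuedContinuity.

(** Away from the diagonal the defining quotient is continuous; on the diagonal
    the mean is squeezed between its two arguments. *)
Lemma continuous_logmean_pair (a b : R) :
  0 < a -> 0 < b ->
  continuous (fun z : R * R => logmean (fst z) (snd z)) (a, b).
Proof.
  intros ha hb.
  assert (hfst : continuous (fun z : R * R => fst z) (a, b))
    by apply continuous_fst.
  assert (hsnd : continuous (fun z : R * R => snd z) (a, b))
    by apply continuous_snd.
  destruct (Req_dec_T a b) as [<- | hab].
  - apply filterlim_locally; intros eps; simpl.
    rewrite logmean_diag.
    set (d := mkposreal (Rmin eps a) (Rmin_pos _ _ (cond_pos eps) ha)).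
    pose proof (Rmin_l eps a : d <= eps). pose proof (Rmin_r eps a : d <= a).
    exists d; intros [x y] [hx hy].
    change (Rabs (x - a) < d) in hx; change (Rabs (y - a) < d) in hy.
    change (Rabs (logmean x y - a) < eps).
    apply Rabs_def2 in hx; apply Rabs_def2 in hy.
    assert (hx0 : 0 < x) by lra. assert (hy0 : 0 < y) by lra.
    pose proof (logmean_between x y hx0 hy0) as hm.
    assert (a - eps < Rmin x y) by (apply Rmin_glb_lt; lra).
    assert (Rmax x y < a + eps) by (apply Rmax_lub_lt; lra).
    apply Rabs_def1; lra.
  - apply continuous_ext_loc with
      (fun z : R * R => (fst z - snd z) / (ln (fst z) - ln (snd z))).
    + assert (hd : continuous (fun z : R * R => fst z - snd z) (a, b))
        by now apply continuous_Rminus.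
      assert (hopen : locally (a - b) (fun t => t <> 0))
        by (apply open_neq; lra).
      assert (hne : locally (a, b) (fun z : R * R => fst z - snd z <> 0))
        by exact (hd _ hopen).
      revert hne; apply filter_imp; intros [x y] hz.
      unfold logmean, jump; simpl in *; destruct (Req_dec_T x y) as [e | _];
        [| reflexivity].
      now destruct hz; apply Rminus_diag_eq.
    + apply continuous_Rdiv; [now apply continuous_Rminus | |].
      * apply continuous_Rminus.
        -- apply (continuous_comp (fun z : R * R => fst z) ln);
             [assumption | now apply continuous_ln].
        -- apply (continuous_comp (fun z : R * R => snd z) ln);
             [assumption | now apply continuous_ln].
      * now apply ln_jump_neq_0.
Qed.

Lemma continuous_logmean {U : UniformSpace} (f g : U -> R) (x : U) :
  continuous f x -> continuous g x -> 0 < f x -> 0 < g x ->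
  continuous (fun y => logmean (f y) (g y)) x.
Proof.
  intros hf hg hf0 hg0; apply (continuous_comp_2 f g logmean); trivial.
  now apply continuous_logmean_pair.
Qed.

Lemma eq_of_eq_punctured_nbhd (f g : R -> R) (x : R) :
  continuous f x -> continuous g x ->
  locally x (fun t => t <> x -> f t = g t) -> f x = g x.
Proof.
  intros hf hg h.
  assert (lim : forall k : R -> R, continuous k x -> is_lim k x (k x)).
  { intros k hk; apply is_lim_continuity, continuity_pt_filterlim, hk. }
  assert (e : Finite (f x) = Finite (g x)).
  { rewrite <- (is_lim_unique g x (g x)) by auto.
    symmetry; apply is_lim_unique.
    apply is_lim_ext_loc with f; [exact h | auto]. }
  now injection e.
Qed.

Lemma continuous_rho (a : vec3) : continuous rho a.
Proof.
  destruct a as [[r v] p]; apply (continuous_comp (fun a : vec3 => fst a) fst);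
    apply continuous_fst.
Qed.

Lemma continuous_vel (a : vec3) : continuous vel a.
Proof.
  destruct a as [[r v] p]; apply (continuous_comp (fun a : vec3 => fst a) snd);
    [apply continuous_fst | apply continuous_snd].
Qed.

Lemma continuous_prs (a : vec3) : continuous prs a.
Proof. destruct a as [w p]; apply continuous_snd. Qed.

Lemma continuous_fnum_star (gamma : R) (up um : vec3) :
  is_state up -> is_state um ->
  continuous (fun u : vec3 * vec3 => fnum_star gamma (fst u) (snd u)) (up, um).
Proof.
  intros [hrp hpp] [hrm hpm].
  assert (of_plus : forall h : vec3 -> R, continuous h up ->
    continuous (fun u : vec3 * vec3 => h (fst u)) (up, um)).
  { intros h hh; apply (continuous_comp (fun u : vec3 * vec3 => fst u) h);
      [apply continuous_fst | exact hh]. }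
  assert (of_minus : forall h : vec3 -> R, continuous h um ->
    continuous (fun u : vec3 * vec3 => h (snd u)) (up, um)).
  { intros h hh; apply (continuous_comp (fun u : vec3 * vec3 => snd u) h);
      [apply continuous_snd | exact hh]. }
  pose proof (of_plus _ (continuous_rho up)) as crp.
  pose proof (of_minus _ (continuous_rho um)) as crm.
  pose proof (of_plus _ (continuous_vel up)) as cvp.
  pose proof (of_minus _ (continuous_vel um)) as cvm.
  pose proof (of_plus _ (continuous_prs up)) as cpp.
  pose proof (of_minus _ (continuous_prs um)) as cpm.
  pose proof (continuous_Rdiv _ _ _ crp cpp (Rgt_not_eq _ _ hpp)) as cbp.
  pose proof (continuous_Rdiv _ _ _ crm cpm (Rgt_not_eq _ _ hpm)) as cbm.
  pose proof (Rdiv_lt_0_compat _ _ hrp hpp) as hbp.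
  pose proof (Rdiv_lt_0_compat _ _ hrm hpm) as hbm.
  pose proof (continuous_logmean _ _ _ crp crm hrp hrm) as crl.
  pose proof (continuous_logmean _ _ _ cbp cbm hbp hbm) as cbl.
  pose proof (continuous_comp _ Rinv _ cbl
    (continuous_Rinv _ (Rgt_not_eq _ _ (logmean_pos _ _ hbp hbm)))) as cbi.
  assert (cconst : forall c : R, continuous (fun _ : vec3 * vec3 => c) (up, um))
    by (intros c; apply continuous_const).
  unfold fnum_star, avg, prodmean; cbv zeta.
  refine (continuous_pair _ _ _ (continuous_pair _ _ _ _ _) _);
    simpl pow; unfold Rdiv in *;
    repeat first [ assumption | apply cconst
                 | apply continuous_Rplus | apply continuous_Rmult ].
Qed.

(** * Entropy conservation in terms of [rho] and [rho / p] *)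

(** Writing [p = rho / beta], the logarithm in the first entropy variable splits
    as [- s / (gamma - 1) = ln rho + ln beta / (gamma - 1)]; these are the two
    logarithms whose jumps the two logarithmic means of the flux cancel. *)
Lemma entropy_s_split (gamma : R) (a : vec3) :
  is_state a ->
  entropy_s gamma a = - ln (rho a / prs a) - (gamma - 1) * ln (rho a).
Proof.
  intros [hr hp]; unfold entropy_s.
  rewrite !ln_div by (trivial; apply exp_pos).
  unfold Rpower; rewrite ln_exp; ring.
Qed.

(** The logarithmic means dispose of the logarithms.  What remains is
    [- jump (beta v^2) / 2 + jump (beta v) avg v = jump beta (v_+ v_-) / 2],
    which explains the kinetic term of the energy flux, and the analogous
    product rule for [rho = beta p], which explains the product mean of [p]
    and [v]. *)
Lemma EC_fnum_star (gamma : R) : 1 < gamma -> EC gamma (fnum_star gamma).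
Proof.
  intros hg up um hup hum.
  unfold dot, vsub, entropy_var, fnum_star, flux_potential; cbv zeta;
    simpl fst; simpl snd.
  rewrite !entropy_s_split by assumption.
  destruct hup as [hrp hpp], hum as [hrm hpm].
  assert (hbp : 0 < rho up / prs up) by now apply Rdiv_lt_0_compat.
  assert (hbm : 0 < rho um / prs um) by now apply Rdiv_lt_0_compat.
  pose proof (logmean_mul_ln_jump _ _ hrp hrm) as er.
  pose proof (logmean_mul_ln_jump _ _ hbp hbm) as eb.
  pose proof (logmean_pos _ _ hbp hbm) as pb.
  unfold jump, avg, prodmean.
  revert er eb pb.
  generalize (logmean (rho up) (rho um)) (ln (rho up)) (ln (rho um))
    (logmean (rho up / prs up) (rho um / prs um))
    (ln (rho up / prs up)) (ln (rho um / prs um)).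
  intros L lp lm B bp bm er eb pb.
  destruct up as [[rp vp] pp], um as [[rm vm] pm].
  unfold rho, vel, prs in *; simpl in *.
  (* Once [ln beta_+] is eliminated, the entropy defect is exactly the average
     velocity times the defect of the relation [er]. *)
  assert (ebp : bp = bm + (rp / pp - rm / pm) / B)
    by (rewrite <- eb; field; lra).
  assert (erp : L * lp = L * lm + (rp - rm)) by lra.
  rewrite ebp.
  transitivity ((L * lp - L * lm - (rp - rm)) * ((vp + vm) / 2));
    [field; lra | rewrite erp; ring].
Qed.

(** For equal velocities and a KEP flux, the momentum flux can be eliminated
    from the entropy balance, which becomes one linear relation between the
    density flux and the energy flux. *)
Lemma EC_balance_equal_velocity (gamma : R) (fnum : vec3 -> vec3 -> vec3)
    (rp pp rm pm v : R) :
  1 < gamma -> EC gamma fnum -> KEP fnum ->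
  0 < rp -> 0 < pp -> 0 < rm -> 0 < pm ->
  let F := fnum (rp, v, pp) (rm, v, pm) in
  (ln rp - ln rm) * f_rho F
    + (ln (rp / pp) - ln (rm / pm)) / (gamma - 1) * f_rho F
    + (rp / pp - rm / pm)
        * (/ 2 * v ^ 2 * f_rho F + v * avg pp pm - f_ene F)
  = v * (rp - rm).
Proof.
  intros hg hec hkep hrp hpp hrm hpm F.
  assert (sp : is_state (rp, v, pp)) by now split.
  assert (sm : is_state (rm, v, pm)) by now split.
  pose proof (hec _ _ sp sm) as e; pose proof (hkep _ _ sp sm) as k.
  unfold dot, vsub, entropy_var, flux_potential in e;
    simpl fst in e; simpl snd in e.
  rewrite !entropy_s_split in e by assumption.
  fold F in e, k.
  change (fst (fst F)) with (f_rho F) in e.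
  change (snd (fst F)) with (f_mom F) in e.
  change (snd F) with (f_ene F) in e.
  rewrite k in e; unfold jump, avg, rho, vel, prs in *; simpl in *.
  apply Rminus_diag_uniq; rewrite <- e; field; lra.
Qed.

(** * Consistency, KEP and PEP *)

Lemma fnum_star_consistent (gamma : R) (u : vec3) :
  1 < gamma -> is_state u -> fnum_star gamma u u = euler_flux gamma u.
Proof.
  intros hg [hr hp]; unfold fnum_star, euler_flux, energy, avg, prodmean; cbv zeta.
  rewrite !logmean_diag.
  apply f_equal2; [apply f_equal2 |]; field; lra.
Qed.

Lemma KEP_fnum_star (gamma : R) : KEP (fnum_star gamma).
Proof. intros up um _ _; unfold f_mom, f_rho, fnum_star; simpl; ring. Qed.

(** At constant [p] the internal energy term loses its dependence on [rho]: by
    homogeneity the mean of [rho] over the mean of [rho / p] is [p]. *)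
Lemma PEP_fnum_star (gamma : R) : 1 < gamma -> PEP (fnum_star gamma).
Proof.
  intros hg; exists (fun p _ => p), (fun p v => / (gamma - 1) * p * v + p * v).
  intros up um [hrp hpp] [hrm hpm] v p e1 e2 e3 e4.
  unfold fnum_star, f_mom, f_ene, f_rho; cbv zeta; simpl fst; simpl snd.
  rewrite e3 in hpp.
  rewrite e1, e2, e3, e4, logmean_div by assumption.
  pose proof (logmean_pos _ _ hrp hrm).
  unfold avg, prodmean; split; field; lra.
Qed.

(** * Uniqueness at equal velocities *)

Section Uniqueness.
Variables (gamma : R) (fnum : vec3 -> vec3 -> vec3).
Hypotheses (hgamma : 1 < gamma) (hnum : numerical_flux gamma fnum)
  (hec : EC gamma fnum) (hkep : KEP fnum) (hpep : PEP fnum)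
  (hindep : density_flux_indep_pressure fnum).

(** Consistency identifies the constant of pressure equilibrium: it is the
    energy flux of a constant state minus its kinetic part. *)
Lemma energy_flux_pressure_equilibrium (rp rm v p : R) :
  0 < rp -> 0 < rm -> 0 < p ->
  f_ene (fnum (rp, v, p) (rm, v, p)) =
    / 2 * v ^ 2 * f_rho (fnum (rp, v, p) (rm, v, p))
      + gamma / (gamma - 1) * p * v.
Proof.
  intros hrp hrm hp.
  destruct hnum as [_ hcons], hpep as (cm & ce & hc).
  assert (sp : is_state (rp, v, p)) by now split.
  assert (sm : is_state (rm, v, p)) by now split.
  destruct (hc _ _ sp sm v p) as [_ e]; trivial.
  destruct (hc _ _ sp sp v p) as [_ e0]; trivial.
  rewrite (hcons _ sp) in e0.
  unfold euler_flux, energy, f_ene, f_rho, rho, vel, prs in e0; simpl in e0.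
  rewrite e; f_equal.
  apply Rplus_eq_reg_l with (/ 2 * (v * (v * 1)) * (rp * v)).
  rewrite <- e0; field; lra.
Qed.

(** At equal pressures [ln (rho / p)] and [ln rho] have the same jump and the
    energy flux is known, so the entropy balance determines the density flux;
    by pressure independence the result extends to all pressures. *)
Lemma density_flux_unique (rp pp rm pm v : R) :
  0 < rp -> 0 < pp -> 0 < rm -> 0 < pm ->
  f_rho (fnum (rp, v, pp) (rm, v, pm)) =
  f_rho (fnum_star gamma (rp, v, pp) (rm, v, pm)).
Proof.
  intros hrp hpp hrm hpm.
  transitivity (logmean rp rm * v);
    [| unfold f_rho, fnum_star, avg, rho, vel; simpl; field].
  rewrite (hindep rp rm v v pp pm 1 1) by lra.
  destruct (Req_dec_T rp rm) as [<- | hr].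
  - destruct hnum as [_ hcons].
    rewrite hcons, logmean_diag by (split; unfold rho, prs; simpl; lra).
    reflexivity.
  - (* At pressure 1, [rho / p] is [rho], and the balance reads
       [gamma / (gamma - 1) * (jump (ln rho) * f - v * jump rho) = 0]. *)
    pose proof (EC_balance_equal_velocity gamma fnum rp 1 rm 1 v hgamma hec hkep
      hrp Rlt_0_1 hrm Rlt_0_1) as e; cbv zeta in e.
    rewrite (energy_flux_pressure_equilibrium rp rm v 1) in e by lra.
    rewrite !Rdiv_1_r in e.
    pose proof (logmean_mul_ln_jump rp rm hrp hrm) as el.
    apply (Rmult_eq_reg_r (ln rp - ln rm)); [| now apply ln_jump_neq_0].
    unfold avg in e.
    set (f := f_rho _) in *.
    replace (logmean rp rm * v * (ln rp - ln rm))
      with (v * (logmean rp rm * (ln rp - ln rm))) by ring.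
    rewrite el.
    apply (Rmult_eq_reg_l (gamma / (gamma - 1))).
    2: { apply Rgt_not_eq, Rdiv_lt_0_compat; lra. }
    apply Rminus_diag_uniq.
    transitivity ((ln rp - ln rm) * f + (ln rp - ln rm) / (gamma - 1) * f +
      (rp - rm) * (/ 2 * v ^ 2 * f + v * ((1 + 1) / 2) -
      (/ 2 * v ^ 2 * f + gamma / (gamma - 1) * 1 * v)) - v * (rp - rm));
      [field; lra | lra].
Qed.

(** [fnum] and [fnum_star] satisfy the same linear relation with the same
    density flux, and the energy flux enters it with coefficient
    [- jump (rho / p)]. *)
Lemma energy_flux_unique_neq (rp pp rm pm v : R) :
  0 < rp -> 0 < pp -> 0 < rm -> 0 < pm -> rp / pp <> rm / pm ->
  f_ene (fnum (rp, v, pp) (rm, v, pm)) =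
  f_ene (fnum_star gamma (rp, v, pp) (rm, v, pm)).
Proof.
  intros hrp hpp hrm hpm hb.
  assert (sp : is_state (rp, v, pp)) by now split.
  assert (sm : is_state (rm, v, pm)) by now split.
  pose proof (EC_balance_equal_velocity gamma fnum rp pp rm pm v hgamma hec hkep
    hrp hpp hrm hpm) as e; cbv zeta in e.
  pose proof (EC_balance_equal_velocity gamma (fnum_star gamma) rp pp rm pm v
    hgamma (EC_fnum_star gamma hgamma) (KEP_fnum_star gamma) hrp hpp hrm hpm) as e';
    cbv zeta in e'.
  rewrite density_flux_unique in e by assumption.
  apply (Rmult_eq_reg_l (rp / pp - rm / pm)); lra.
Qed.

(** The entropy balance says nothing about the energy flux when [rho / p] does
    not jump; such pairs are limits, in [p_+], of pairs where it does. *)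
Lemma energy_flux_unique (rp pp rm pm v : R) :
  0 < rp -> 0 < pp -> 0 < rm -> 0 < pm ->
  f_ene (fnum (rp, v, pp) (rm, v, pm)) =
  f_ene (fnum_star gamma (rp, v, pp) (rm, v, pm)).
Proof.
  intros hrp hpp hrm hpm.
  destruct (Req_dec_T (rp / pp) (rm / pm)) as [hb | hb];
    [| now apply energy_flux_unique_neq].
  assert (sp : is_state (rp, v, pp)) by now split.
  assert (sm : is_state (rm, v, pm)) by now split.
  assert (cont : forall g : vec3 -> vec3 -> vec3,
    continuous (fun u : vec3 * vec3 => g (fst u) (snd u))
      ((rp, v, pp), (rm, v, pm)) ->
    continuous (fun t : R => f_ene (g (rp, v, t) (rm, v, pm))) pp).
  { intros g hg.
    apply (continuous_comp (fun t : R => g (rp, v, t) (rm, v, pm)) f_ene).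
    - apply (continuous_comp_2 (fun t : R => (rp, v, t) : vec3)
        (fun _ : R => (rm, v, pm) : vec3) g); trivial.
      + apply continuous_pair; [apply continuous_const | apply continuous_id].
      + apply continuous_const.
    - destruct (g _ _) as [m n]; apply continuous_snd. }
  apply (eq_of_eq_punctured_nbhd
    (fun t => f_ene (fnum (rp, v, t) (rm, v, pm)))
    (fun t => f_ene (fnum_star gamma (rp, v, t) (rm, v, pm)))).
  - apply cont, hnum; assumption.
  - apply cont, continuous_fnum_star; assumption.
  - assert (hpos : locally pp (fun t => 0 < t)) by now apply open_gt.
    revert hpos; apply filter_imp; intros t ht hne.
    apply energy_flux_unique_neq; trivial.
    (* Since [rho_+ / p_+ = rho_- / p_-], any [t <> p_+] makes [rho / p] jump. *)
    rewrite <- hb; intros e; apply hne.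
    apply Rinv_eq_reg, (Rmult_eq_reg_l rp); [exact e | lra].
Qed.

End Uniqueness.

(** * The characterization *)

Theorem theorem2p5 (gamma : R) (hgamma : 1 < gamma) :
  (numerical_flux gamma (fnum_star gamma) /\
   EC gamma (fnum_star gamma) /\
   KEP (fnum_star gamma) /\
   PEP (fnum_star gamma) /\
   density_flux_indep_pressure (fnum_star gamma)) /\
  (forall fnum : vec3 -> vec3 -> vec3,
     numerical_flux gamma fnum ->
     EC gamma fnum ->
     KEP fnum ->
     PEP fnum ->
     density_flux_indep_pressure fnum ->
     forall up um : vec3, is_state up -> is_state um ->
       vel up = vel um ->
       fnum up um = fnum_star gamma up um).
Proof.
  split.
  - split; [split |].
    + intros; now apply continuous_fnum_star.
    + intros; now apply fnum_star_consistent.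
    + split; [now apply EC_fnum_star |].
      split; [apply KEP_fnum_star |].
      split; [now apply PEP_fnum_star | intro; reflexivity].
  - intros fnum hnum hec hkep hpep hindep up um sp sm hv.
    assert (er : f_rho (fnum up um) = f_rho (fnum_star gamma up um)).
    { destruct up as [[rp v] pp], um as [[rm v'] pm], sp, sm.
      unfold vel in hv; simpl in hv; subst v'.
      now apply density_flux_unique. }
    assert (em : f_mom (fnum up um) = f_mom (fnum_star gamma up um))
      by now rewrite hkep, KEP_fnum_star, er.
    assert (ee : f_ene (fnum up um) = f_ene (fnum_star gamma up um)).
    { destruct up as [[rp v] pp], um as [[rm v'] pm], sp, sm.
      unfold vel in hv; simpl in hv; subst v'.
      now apply energy_flux_unique. }
    destruct (fnum up um) as [[a b] c], (fnum_star gamma up um) as [[a' b'] c'].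
    unfold f_rho, f_mom, f_ene in *; simpl in *; congruence.
Qed.
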